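(* Let $U=(U_{ij})_{i,j\in I}$ be a nonsingular $\mathcal U$-matrix with supporting dyadic tree $(T,\mathcal J)$, root $r$ (identified with $I$) and distinguished leaf $n$. Then: (i) for a leaf $i\neq n$, $i\in\mathcal R$ if and only if $\mathrm{geod}(i,I)\cap\Gamma=\emptyset$; (ii) for every vertex $L\in T$ and every leaf $i\in L$ with $i\ne n$, $i\in\mathcal R_L$ if and only if $\mathrm{geod}(i,L)\cap\Gamma=\emptyset$ (paths regarded as sets of edges).
   Context: Trees. $(T,\mathcal J)$ is a finite tree with a distinguished root $r$; $\mathrm{geod}(s,t)$ is the unique shortest path between vertices $s,t$ (also regarded as its set of edges). Write $s\preceq t$ if $s$ lies on $\mathrm{geod}(t,r)$. $s\wedge t$ is the $\preceq$-largest vertex lying on both $\mathrm{geod}(s,r)$ and $\mathrm{geod}(t,r)$. Successors of $t$ are its neighbours $s\ne t$ with $t\preceq s$; leaves are vertices without successors, their set is $I$. Dyadic: every non-leaf $t$ has exactly two successors $t^-,t^+$. Each vertex $t$ is identified with the set of leaves $i$ with $t\preceq i$ (so $r$ is identified with $I$; ''$i\in L$'' means $i$ is a leaf below $L$). Edges are written $(L,L^-)$, $(L,L^+)$. $\mathcal U$-matrices. A real matrix $U=(U_{ij})_{i,j\in I}$ is a $\mathcal U$-matrix if there exist a dyadic tree with root $r$ and leaf set $I$, a distinguished leaf $n$, and nonnegative vectors $(\alpha_t)_{t\in T},(\beta_t)_{t\in T}$ with: (i) $\alpha_i=\beta_i$ for leaves $i$, and $\alpha_t=\alpha_{t\wedge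 n}$ for every non-leaf $t$ with $r^+\preceq t$; (ii) $\alpha_t\le\beta_t$; (iii) $t\preceq s\Rightarrow \alpha_t\le\alpha_s,\ \beta_t\le\beta_s$; (iv) for every non-leaf $t$ on $\mathrm{geod}(r,n)$, $t^+$ lies on $\mathrm{geod}(r,n)$, and $\alpha_t=\beta_t$ for $t$ on $\mathrm{geod}(r,n)$; (v) $U_{ii}=\alpha_i$, and for $i\ne j$, $t=i\wedge j$: $U_{ij}=\alpha_t$ if $i\in t^-,j\in t^+$; $U_{ij}=\beta_s$ if $i\in t^+,j\in t^-$, where $s$ is the $\preceq$-larger of $i\wedge j$ and $i\wedge n$. Leaves are labelled $I=\{1,\dots,n\}$ so that $i<j$ iff $i\in(i\wedge j)^-$, $j\in(i\wedge j)^+$; the distinguished leaf is the label $n$. Potentials and exiting roots. For a vertex $L$ let $U_L=U|_{L\times L}$ (nonsingular whenever $U$ is), $\mu_L=U_L^{-1}\mathbf 1$, $\mathcal R_L=\{i\in L:(\mu_L)_i>0\}$, and $\mathcal R=\mathcal R_I$. (Equivalently, with $P=E-\eta^{-1}U^{-1}$ for $\eta\ge\max_i (U^{-1})_{ii}$, $i\in\mathcal R$ iff $(P\mathbf 1)_i<1$; these are the exiting roots of $P$.) The set $\Gamma$ of edges. For a leaf $i$ let $N_i^+=\{L\in T:L\preceq i,\ \alpha_L=\alpha_i\}$ and $N_i^-=\{L\in T:L\preceq i,\ \beta_L=\beta_i\}$. For each non-leaf $L$: $(L,L^-)\in\Gamma$ iff there is $i\in L^+$ with $L\in N_i^+$;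 $(L,L^+)\in\Gamma$ iff there is $i\in L^-$ with $L\in N_i^-$. *)

(* Defs.v *)
From mathcomp Require Import all_boot all_order all_algebra.
Set Implicit Arguments.
Unset Strict Implicit.
Unset Printing Implicit Defensive.
Import Order.TTheory GRing.Theory Num.Theory.

Section RootedTree.
Variables (T : finType) (J : rel T).

(* [ucycle] with at most two elements is only an edge walked back and forth. *)
Definition is_tree : Prop :=
  [/\ symmetric J, irreflexive J, forall s t, connect J s t
    & forall c : seq T, ucycle J c -> size c <= 2].

Definition walk (s t : T) (p : seq T) : bool := path J s p && (last s p == t).

(* Bounding the length by #|T| loses nothing: a shortest walk has no repeated
   vertex. *)
Definition shortest (s t : T) (p : #|T|.-bseq T) : bool :=
  walk s t p && [forall q : #|T|.-bseq T, walk s t q ==> (size p <= size q)].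

Definition geod (s t : T) : seq T :=
  if [pick p | shortest s t p] is Some p then s :: p else [::].

(* The edges are unoriented, hence encoded as two-element sets of vertices. *)
Definition geod_edges (s t : T) : {set {set T}} :=
  [set [set e.1; e.2] | e in zip (geod s t) (behead (geod s t))].

Variable r : T.

Definition tle (s t : T) : bool := s \in geod t r.

Definition common_anc (s t : T) : {set T} :=
  [set v | (v \in geod s r) && (v \in geod t r)].

Definition tmeet (s t : T) : T :=
  odflt r [pick m in common_anc s t | [forall v in common_anc s t, tle v m]].

Definition succs (t : T) : {set T} := [set s | [&& J t s, s != t & tle t s]].

Definition leaf (t : T) : bool := succs t == set0.

End RootedTree.

(* A dyadic rooted tree with leaves labelled 'I_m.+1, the label k : 'I_m.+1
   standing for k.+1 in {1, ..., n} with n = m.+1.  [tminus] and [tplus] are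
   meaningful on non-leaves only. *)
Record dyadicTree (m : nat) := DyadicTree {
  vertex :> finType;
  adj : rel vertex;
  troot : vertex;
  tminus : vertex -> vertex;
  tplus : vertex -> vertex;
  lf : 'I_m.+1 -> vertex;
  adj_tree : is_tree adj;
  dyadic : forall t, ~~ leaf adj troot t ->
    tminus t != tplus t /\ succs adj troot t = [set tminus t; tplus t];
  lf_inj : injective lf;
  lf_image : forall t, reflect (exists i, lf i = t) (leaf adj troot t);
  lf_order : forall i j : 'I_m.+1, i != j ->
    let t := tmeet adj troot (lf i) (lf j) in
    (i < j) = tle adj troot (tminus t) (lf i) && tle adj troot (tplus t) (lf j)
}.

Section DyadicTree.
Variables (m : nat) (D : dyadicTree m).

Definition dle (s t : D) : bool := tle (@adj m D) (troot D) s t.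
Definition dmeet (s t : D) : D := tmeet (@adj m D) (troot D) s t.
Definition dleaf (t : D) : bool := leaf (@adj m D) (troot D) t.
Definition dgeod (s t : D) : seq D := geod (@adj m D) s t.
Definition dgeod_edges (s t : D) : {set {set D}} := geod_edges (@adj m D) s t.

(* The distinguished leaf: the one with the last label. *)
Definition lfn : D := lf D ord_max.

(* The set of leaf labels with which a vertex is identified. *)
Definition below (L : D) : {set 'I_m.+1} := [set i | dle L (lf D i)].

(* The larger of two [dle]-comparable vertices. *)
Definition dmax (s t : D) : D := if dle s t then t else s.

End DyadicTree.

Local Open Scope ring_scope.

Section Umatrix.
Variables (R : realFieldType) (m : nat) (D : dyadicTree m).
Variables (alpha beta : D -> R).

Record is_Umatrix (U : 'M[R]_m.+1) : Prop := IsUmatrix {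
  U_nonneg : forall t : D, 0 <= alpha t /\ 0 <= beta t;
  U_leaf : forall i, alpha (lf D i) = beta (lf D i);
  U_const : forall t : D, ~~ dleaf t -> dle (tplus (troot D)) t ->
    alpha t = alpha (dmeet t (lfn D));
  U_le : forall t : D, alpha t <= beta t;
  U_mono : forall t s : D, dle t s -> alpha t <= alpha s /\ beta t <= beta s;
  U_spine : forall t : D, t \in dgeod (troot D) (lfn D) -> ~~ dleaf t ->
    tplus t \in dgeod (troot D) (lfn D);
  U_spine_eq : forall t : D, t \in dgeod (troot D) (lfn D) -> alpha t = beta t;
  U_diag : forall i, U i i = alpha (lf D i);
  U_upper : forall i j, i != j ->
    let t := dmeet (lf D i) (lf D j) in
    i \in below (tminus t) -> j \in below (tplus t) -> U i j = alpha t;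
  U_lower : forall i j, i != j ->
    let t := dmeet (lf D i) (lf D j) in
    i \in below (tplus t) -> j \in below (tminus t) ->
    U i j = beta (dmax t (dmeet (lf D i) (lfn D)))
}.

Definition Nplus (i : 'I_m.+1) : {set D} :=
  [set L : D | dle L (lf D i) && (alpha L == alpha (lf D i))].

Definition Nminus (i : 'I_m.+1) : {set D} :=
  [set L : D | dle L (lf D i) && (beta L == beta (lf D i))].

Definition Gamma : {set {set D}} :=
  [set [set L; tminus L] | L : D
     & ~~ dleaf L && [exists i in below (tplus L), L \in Nplus i]]
  :|: [set [set L; tplus L] | L : D
     & ~~ dleaf L && [exists i in below (tminus L), L \in Nminus i]].

End Umatrix.

Definition potential (R : realFieldType) (k : nat) (V : 'M[R]_k) : 'cV[R]_k :=
  invmx V *m const_mx 1.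

Definition exit_roots (R : realFieldType) (k : nat) (V : 'M[R]_k) : {set 'I_k} :=
  [set i | 0 < potential V i 0].

(* [enum_val : 'I_#|S| -> 'I_k] lists the elements of S; it is used both to
   form the submatrix indexed by S and to transport its roots back. *)
Definition submx_on (R : realFieldType) (k : nat) (S : {set 'I_k})
    (V : 'M[R]_k) : 'M[R]_#|S| :=
  mxsub (@enum_val _ (mem S)) (@enum_val _ (mem S)) V.

Definition exit_roots_on (R : realFieldType) (k : nat) (S : {set 'I_k})
    (V : 'M[R]_k) : {set 'I_k} :=
  [set enum_val i | i in exit_roots (submx_on S V)].

(* Main.v *)
Require Import Defs.
From mathcomp Require Import all_boot all_order all_algebra.
From mathcomp Require Import ring lra.
Set Implicit Arguments.
Unset Strict Implicit.
Unset Printing Implicit Defensive.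
Import Order.TTheory GRing.Theory Num.Theory.

(* The potential mu_L is computed by induction on L from those of A = L^- and
   B = L^+, which it rescales.

   If the last leaf n is not below L, the two off-diagonal blocks of U_L are
   constant, equal to alpha_L and beta_L, so that mu_L = (x mu_A, y mu_B) with
   x + alpha_L y |mu_B| = 1 and y + beta_L x |mu_A| = 1, where |.| is the sum of
   the entries.  By induction beta_L |mu_L| <= 1, with equality iff
   beta_L = alpha_i for some leaf i below L; hence x, y >= 0, and x = 0 (resp.
   y = 0) exactly when (L, L^-) (resp. (L, L^+)) is in Gamma.

   If n is below L, the column n of U_B is repeated in the lower left block, so
   that mu_L = (x mu_A, mu_B - x |mu_A| e_n) with
   x (1 - alpha_L |mu_A|) = 1 - alpha_L |mu_B|, and |mu_B| = 1 / alpha_n because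
   the row n of U_B is constant.  Nonsingularity gives alpha_L |mu_A| < 1, that
   is, (L, L^+) is not in Gamma. *)

(** * Geodesics in rooted trees *)

Section Trees.
Variables (T : finType) (J : rel T).
Hypothesis treeJ : is_tree J.

(** Between the vertex where two such paths part and the first one where they meet again, they would
    enclose a cycle of more than two vertices. *)
Lemma simple_path_unique x p q :
    path J x p -> uniq (x :: p) -> path J x q -> uniq (x :: q) ->
  last x p = last x q -> p = q.
Proof.
have [symJ _ _ acyc] := treeJ.
elim: p x q => [|a p IH] x [|b q] //.
- move=> _ _ _ /= /andP[xq _] xl; case/negP: xq.
  by rewrite {1}xl mem_last.
- move=> _ /= /andP[xp _] _ _ xl; case/negP: xp.
  by rewrite -{1}xl mem_last.
have [<-|neq_ab] := eqVneq a b.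
  move=> /= /andP[_ pp] /andP[_ up] /andP[_ pq] /andP[_ uq] lpq.
  by congr (_ :: _); apply: IH lpq.
move=> pp up pq uq /= lpq; exfalso; move: pp up pq uq.
have: has (mem (b :: q)) (a :: p).
  by apply/hasP; exists (last a p); rewrite ?mem_last //= lpq mem_last.
have: head x (a :: p) != head x (b :: q) by [].
move: (a :: p) (b :: q) => {IH neq_ab lpq}s t nst.
move=> hs; case: (split_find hs) nst => y p1 p2 /= yt p1t nst {s hs}.
case/splitPr: yt nst p1t => q1 q2 nst p1t.
move=> pp /andP[xp up] pq /andP[xq uq].
move: pp; rewrite cat_path => /andP[pp _].
move: up; rewrite cat_uniq => /andP[up _].
move: pq; rewrite cat_path => /andP[pq1 /andP[yJ _]].
move: uq; rewrite cat_uniq /= => /and3P[uq1 yq1 _].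
move: xp xq yq1; rewrite !mem_cat mem_rcons !inE !negb_or.
move=> /andP[/andP[xy xp] _] /and3P[xq _ _] /andP[yq1 _].
(* y is the first vertex of p on q; p1 and q1 lead from x to y *)
pose c := x :: rcons p1 y ++ rev q1.
have : size c <= 2.
  apply: acyc; rewrite /ucycle /c; apply/andP; split.
    rewrite /= rcons_cat cat_path pp last_rcons /=.
    have := rev_path J x (rcons q1 y).
    rewrite last_rcons belast_rcons rev_cons => ->.
    by rewrite (@eq_path _ _ J) ?rcons_path ?pq1.
  move: up; rewrite rcons_uniq => /andP[yp1 up1].
  rewrite cons_uniq mem_cat mem_rcons inE !negb_or mem_rev xy xp xq /=.
  rewrite cat_uniq rcons_uniq yp1 up1 rev_uniq uq1 !andbT /=.
  apply/hasPn => z; rewrite mem_rev mem_rcons inE => zq; apply/norP; split.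
    by apply: contraNneq yq1 => <-.
  by apply: contra p1t => zp; apply/hasP; exists z; rewrite // inE mem_cat zq.
(* The bound forces [p1] and [q1] to be empty, so both paths begin with [y], against [nst]. *)
rewrite /= size_cat size_rcons size_rev.
by case: p1 q1 nst {c p1t pp xp up pq1 yJ xq uq1 yq1} => [|? ?] [|? ?] //=; rewrite eqxx.
Qed.

(** Every walk shortens to a simple path, which is [p] by uniqueness; so [p] is shortest, and a walk
    no longer than [p] is [p] itself. *)
Lemma geod_simple_path x p :
  path J x p -> uniq (x :: p) -> geod J x (last x p) = x :: p.
Proof.
move=> pp up; rewrite /geod.
have short q : walk J x (last x p) q -> (size p <= size q)%N /\
    (size q <= size p -> q = p)%N.
  case/andP=> pq /eqP lq; move: (lq) (pq).
  case/shortenP: pq => p' pp' up' sub lpq pq.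
  have p'E : p' = p by apply: (simple_path_unique (x := x)).
  case/andP: (up') => xp' up1; rewrite -p'E; split; first exact: uniq_leq_size.
  move=> le; have [_ eqi] := uniq_min_size up1 sub le.
  apply/esym/(simple_path_unique (x := x)) => //; first last.
    by rewrite lpq lq.
  by rewrite /= -eqi xp'; apply: leq_size_uniq le.
have sz : (size p <= #|T|)%N.
  by rewrite ltnW // -[(size p).+1]/(size (x :: p)) -(card_uniqP up) max_card.
case: pickP => [p' /andP[wp' /forallP min]|/(_ (Bseq sz))/negP[]].
  congr (_ :: _); have [_ ->] := short p' wp'; rewrite //.
  by have := min (Bseq sz); rewrite /walk /= pp eqxx.
rewrite /shortest /walk /= pp eqxx /=; apply/forallP => q; apply/implyP => wq.
by have [] := short q wq.
Qed.

Lemma geodP s t :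
  exists p, [/\ path J s p, uniq (s :: p), last s p = t & geod J s t = s :: p].
Proof.
have [_ _ conn _] := treeJ; have /connectP[q pq ->] := conn s t.
case: (shortenP pq) => p pp up _; exists p; split=> //.
exact: geod_simple_path.
Qed.

Lemma geod_sym s t : geod J t s = rev (geod J s t).
Proof.
have [symJ _ _ _] := treeJ; have [p [pp up lp ->]] := geodP s t.
have revE : rev (s :: p) = t :: rev (belast s p).
  by rewrite lastI lp rev_rcons.
rewrite revE -(geod_simple_path (p := rev (belast s p))).
- congr geod; case: (p) lp => [|a p'] //= _.
  by rewrite rev_cons last_rcons.
- by rewrite -lp rev_path (@eq_path _ _ J).
- by rewrite -revE rev_uniq.
Qed.

(** * The order induced by the root *)

Variable r : T.
Notation groot t := (geod J t r).
Notation tle := (tle J r).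

Lemma geod_head t : exists p, groot t = t :: p.
Proof. by have [p [_ _ _ ->]] := geodP t r; exists p. Qed.

Lemma geod_uniq t : uniq (groot t).
Proof. by have [p [_ ? _ ->]] := geodP t r. Qed.

Lemma geod_inj s t : groot s = groot t -> s = t.
Proof.
by have [p ->] := geod_head s; have [q ->] := geod_head t; case.
Qed.

Lemma suffix_geod t c q : suffix (c :: q) (groot t) -> groot c = c :: q.
Proof.
have [p [pp up lp ->]] := geodP t r; case/suffixP => p1 pE.
have lq : last c q = r.
  by rewrite -lp -[last t p]/(last t (t :: p)) pE last_cat.
rewrite -lq; apply: geod_simple_path.
  have: sorted J (t :: p) by [].
  by rewrite pE; case: p1 {pE} => [|b p1] //=; rewrite cat_path => /and3P[].
by move: up; rewrite pE cat_uniq => /and3P[].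
Qed.

Lemma geod_cat s t : tle s t ->
  exists p, groot t = p ++ groot s /\ geod J t s = rcons p s.
Proof.
rewrite /Defs.tle; have [q [pq uq lq gE]] := geodP t r; rewrite gE.
move=> st; case/splitPl: st pq uq lq gE => q1 q2 lq1 pq uq lq gE.
exists (belast t q1); split.
  have gs : groot s = s :: q2.
    apply: (@suffix_geod t); apply/suffixP; exists (belast t q1).
    by rewrite gE -cat_cons lastI lq1 cat_rcons.
  by rewrite gs -cat_rcons -lq1 -lastI.
rewrite -lq1 -lastI; apply: geod_simple_path.
  by move: pq; rewrite cat_path => /andP[].
by move: uq; rewrite -cat_cons cat_uniq => /andP[].
Qed.

(** Reduces the order properties, in particular comparability of the vertices below a given one, to
    facts about suffixes of a sequence. *)
Lemma tle_suffix s t : tle s t = suffix (groot s) (groot t).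
Proof.
apply/idP/idP => [/geod_cat[p [-> _]]|/suffixP[p pE]]; first exact: suffix_suffix.
by rewrite /Defs.tle pE mem_cat; have [q ->] := geod_head s; rewrite mem_head orbT.
Qed.

Lemma tle_refl t : tle t t.
Proof. by rewrite tle_suffix suffix_refl. Qed.

Lemma tle_trans t s u : tle s t -> tle t u -> tle s u.
Proof. by rewrite !tle_suffix; apply: suffix_trans. Qed.

Lemma tle_anti s t : tle s t -> tle t s -> s = t.
Proof.
rewrite !tle_suffix => st ts; apply: geod_inj.
have/eqP sz : size (groot s) == size (groot t) by rewrite eqn_leq !size_suffix.
by move: st; rewrite suffixE sz subnn drop0 => /eqP.
Qed.

Lemma tle_comparable s t u : tle s u -> tle t u -> tle s t || tle t s.
Proof.
rewrite !tle_suffix.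
wlog szst : s t / size (groot s) <= size (groot t) => [wl su tu|su tu].
  case/orP: (leq_total (size (groot s)) (size (groot t))) => sz; first exact: wl.
  by rewrite orbC; apply: wl.
have tu' := size_suffix tu; move: su tu; rewrite suffixE => /eqP <-.
rewrite [suffix (groot t) _]suffixE => /eqP {1}<-.
have -> : size (groot u) - size (groot s) =
    (size (groot t) - size (groot s)) + (size (groot u) - size (groot t)).
  by rewrite addnBAC // addnBA // addnC addnK.
by rewrite -drop_drop suffix_drop.
Qed.

Lemma tle_root t : tle r t.
Proof.
by have [p [_ _ <- gE]] := geodP t r; rewrite /Defs.tle gE mem_last.
Qed.

Lemma mem_succs s t : (s \in succs J r t) = (groot s == s :: groot t).
Proof.
have [symJ _ _ _] := treeJ; rewrite inE; apply/idP/eqP => [/and3P[Jts nst ts]|gs].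
  have [p [-> ge]] := geod_cat ts; have : geod J s t = [:: s; t].
    by apply: (@geod_simple_path s [:: t]); rewrite /= ?inE ?nst // symJ Jts.
  by rewrite ge -[RHS]/(rcons [:: s] t) => /rcons_inj[->].
have [q tE] := geod_head t; have [p [pp up _ gE]] := geodP s r.
have pE : p = t :: q by move: gE; rewrite gs tE; case.
move: pp up; rewrite pE /= inE negb_or => /andP[Jst _] /andP[/andP[nst _] _].
by rewrite symJ Jst nst tle_suffix gs suffix_cons.
Qed.

Lemma succs_tle s t : s \in succs J r t -> tle t s.
Proof. by rewrite mem_succs tle_suffix => /eqP ->; rewrite suffix_cons. Qed.

Lemma succs_neq s t : s \in succs J r t -> s != t.
Proof. by rewrite inE => /and3P[]. Qed.

Lemma succ_toward t s : tle t s -> t != s ->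
  exists2 c, c \in succs J r t & tle c s.
Proof.
(* The successor is the vertex just before [t] on the geodesic from [s] to the root. *)
move=> /geod_cat[p [gE _]] nts; case: (lastP p) gE => [gE|q c].
  by case/eqP: nts; apply: geod_inj; rewrite gE.
rewrite cat_rcons => gE.
have gc : groot c = c :: groot t.
  by apply: (@suffix_geod s); rewrite gE suffix_suffix.
by exists c; rewrite ?mem_succs ?gc // tle_suffix gE gc suffix_suffix.
Qed.

Lemma tle_succ c t s : c \in succs J r t -> tle s c -> s = c \/ tle s t.
Proof.
rewrite mem_succs => /eqP gc; rewrite /Defs.tle gc inE.
by case/predU1P => [->|]; [left|right].
Qed.

Lemma succ_unique c d t s :
  c \in succs J r t -> d \in succs J r t -> tle c s -> tle d s -> c = d.
Proof.
wlog: c d / tle c d => [wl ct dt cs ds|cd ct dt cs ds].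
  case/orP: (tle_comparable cs ds) => h; first exact: wl.
  by apply/esym; apply: wl.
case: (tle_succ dt cd) => // /(tle_anti (succs_tle ct)) tc.
by move: (succs_neq ct); rewrite tc eqxx.
Qed.

(** * Meets *)

Lemma tmeet_tle s t : tle (tmeet J r s t) s.
Proof.
(* The default value [r] of [tmeet] precedes every vertex. *)
rewrite /tmeet; case: pickP => [m /andP[]|_]; last exact: tle_root.
by rewrite inE => /andP[].
Qed.

Lemma common_ancE s t v : (v \in common_anc J r s t) = tle v s && tle v t.
Proof. by rewrite inE. Qed.

Lemma tmeet_tler s t : tle (tmeet J r s t) t.
Proof.
rewrite /tmeet; case: pickP => [m /andP[]|_]; last exact: tle_root.
by rewrite inE => /andP[].
Qed.

Lemma tmeet_eq m s t : tle m s -> tle m t ->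
  (forall v, tle v s -> tle v t -> tle v m) -> tmeet J r s t = m.
Proof.
move=> ms mt maxm; rewrite /tmeet; case: pickP => [x|/(_ m)/negP[]].
  rewrite common_ancE => /andP[/andP[xs xt] /forall_inP maxx].
  by apply: tle_anti; [apply: maxm | apply: maxx; rewrite common_ancE ms].
rewrite common_ancE ms mt; apply/forall_inP => v.
by rewrite common_ancE => /andP[]; apply: maxm.
Qed.

Lemma tmeetxx s : tmeet J r s s = s.
Proof. by apply: tmeet_eq; rewrite ?tle_refl. Qed.

Lemma tmeet_succs c d m s t :
    c \in succs J r m -> d \in succs J r m -> c != d -> tle c s -> tle d t ->
  tmeet J r s t = m.
Proof.
move=> cm dm ncd cs dt; apply: tmeet_eq.
- exact: tle_trans (succs_tle cm) cs.
- exact: tle_trans (succs_tle dm) dt.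
move=> v vs vt; case/orP: (tle_comparable cs vs) => [cv|vc].
  by case/eqP: ncd; apply: (succ_unique cm dm _ dt); apply: tle_trans vt.
case: (tle_succ cm vc) => // vE; case/eqP: ncd.
by apply: (succ_unique cm dm _ dt); rewrite -vE.
Qed.

(** * Edges of geodesics *)

Lemma edge_inj c d s t : c \in succs J r s -> d \in succs J r t ->
  [set s; c] = [set t; d] -> s = t /\ c = d.
Proof.
move=> cs dt /setP E.
have nc := succs_neq cs.
have := E s; rewrite !inE eqxx /= => /esym/orP[]/eqP sE.
  split=> //; have := E c; rewrite !inE eqxx orbT -sE (negPf nc) => /esym /eqP.
  by [].
(* The reversed edge, [s = d] and [c = t], would make [s] and [c] precede each other. *)
have := E c; rewrite !inE eqxx orbT sE -sE (negPf nc) orbF => /esym/eqP cE.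
by case/eqP: nc; apply: tle_anti; [rewrite cE sE|]; apply: succs_tle.
Qed.

Lemma geod_edges_refl s : geod_edges J s s = set0.
Proof.
rewrite /geod_edges (@geod_simple_path s [::]) //=.
by apply/setP => x; rewrite inE; apply/imsetP => -[].
Qed.

Lemma geod_edges_succ c t s : c \in succs J r t -> tle c s ->
  geod_edges J s t = [set t; c] |: geod_edges J s c.
Proof.
move=> ct cs; have [p [gE gc]] := geod_cat cs.
have [q [gE' gt]] := geod_cat (tle_trans (succs_tle ct) cs).
have qE : q = rcons p c.
  move: ct; rewrite mem_succs => /eqP gcE; move: gE; rewrite gE' gcE -cat_rcons.
  move=> qE; have /eqP szq := congr1 size qE; move/eqP: qE.
  rewrite !size_cat eqn_add2r in szq.
  by rewrite eqseq_cat ?(eqP szq) // => /andP[/eqP].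
have zipE : zip (geod J s t) (behead (geod J s t)) =
  rcons (zip (geod J s c) (behead (geod J s c))) (c, t).
  rewrite gt gc qE; case: p {gE gc qE} => [|a p] //=.
  elim: p a => [|b p IH] a //=. by rewrite IH.
apply/setP => e; apply/imsetP/setU1P.
  case=> x; rewrite zipE mem_rcons inE => /predU1P[-> ->|xz ->].
    by left; rewrite setUC.
  by right; apply: imset_f.
case=> [->|/imsetP[x xz ->]]; last by exists x; rewrite // zipE mem_rcons inE xz orbT.
by exists (c, t); rewrite ?zipE ?mem_rcons ?mem_head // setUC.
Qed.

(** * Induction towards the root and away from it *)

Lemma tree_ind (P : T -> Prop) :
  (forall t, (forall c, c \in succs J r t -> P c) -> P t) -> forall t, P t.
Proof.
move=> step t; have [n le] := ubnP (#|T| - size (groot t)).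
elim: n t le => // n IH t le; apply: step => c ct; apply: IH.
have := max_card (mem (groot c)); rewrite (card_uniqP (geod_uniq c)).
move: ct; rewrite mem_succs => /eqP gc; rewrite gc /= => sz.
by rewrite -ltnS; apply: leq_trans le; rewrite !ltnS subnSK.
Qed.

Lemma tree_ind_from_root (P : T -> Prop) :
  P r -> (forall t c, c \in succs J r t -> P t -> P c) -> forall t, P t.
Proof.
move=> Pr step t; have [n le] := ubnP (size (groot t)).
elim: n t le => // n IH t; have [[|s q] [_ _ lr gt]] := geodP t r.
  by move=> _; rewrite (lr : t = r).
have gs : groot s = s :: q.
  by apply: (@suffix_geod t); rewrite gt; apply: suffix_cons.
rewrite gt /= ltnS => le; apply: (step s); first by rewrite mem_succs gt gs.
by apply: IH; rewrite gs.
Qed.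

End Trees.

Local Open Scope ring_scope.

(** * Potentials of block matrices *)

Section Potentials.
Variables (R : realFieldType) (I : finType) (U : I -> I -> R).
Implicit Types (A B S : {set I}) (u v w : I -> R).

(** Potentials are functions on all of [I], of which only the values on [S] count; blocks can then
    be joined without reindexing. *)
Definition right_potential S u := forall i, i \in S -> \sum_(j in S) U i j * u j = 1.

Definition left_potential S w := forall j, j \in S -> \sum_(i in S) w i * U i j = 1.

Definition nonsingular_on S := forall v,
  (forall i, i \in S -> \sum_(j in S) U i j * v j = 0) ->
  forall i, i \in S -> v i = 0.

Definition glue A u v : I -> R := fun i => if i \in A then u i else v i.

(** Evaluate the product w U v in two ways. With [c = 1], left and right potentials have equal sums;
    with [c = 0], kernel vectors have sum 0. *)
Lemma left_potential_sum S w v c : left_potential S w ->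
    (forall i, i \in S -> \sum_(j in S) U i j * v j = c) ->
  \sum_(i in S) v i = c * \sum_(i in S) w i.
Proof.
move=> wS vS; transitivity (\sum_(j in S) (\sum_(i in S) w i * U i j) * v j).
  by apply: eq_bigr => j jS; rewrite wS // mul1r.
rewrite mulr_sumr (eq_bigr (fun j => \sum_(i in S) w i * U i j * v j)); last first.
  by move=> j _; rewrite mulr_suml.
rewrite exchange_big /=; apply: eq_bigr => i iS; rewrite -(vS i iS) mulr_suml.
by apply: eq_bigr => j _; ring.
Qed.

Lemma sum_glue A B (f : I -> R -> R) u v : [disjoint A & B] ->
  \sum_(j in A :|: B) f j (glue A u v j) =
  \sum_(j in A) f j (u j) + \sum_(j in B) f j (v j).
Proof.
move=> disjAB; rewrite (eq_bigl [predU A & B]) => [|j]; last by rewrite !inE.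
rewrite bigU //=; congr (_ + _); apply: eq_bigr => j jS; rewrite /glue ?jS //.
by rewrite (disjointFl disjAB jS).
Qed.

(* A left potential makes the entries of every kernel vector of the block A sum
   to 0, so that extending the vector by 0 gives a kernel vector of the whole. *)
Lemma nonsingular_part A B w (c : I -> R) : [disjoint A & B] ->
    (forall i j, i \in B -> j \in A -> U i j = c i) ->
  left_potential A w -> nonsingular_on (A :|: B) -> nonsingular_on A.
Proof.
move=> disjAB UBA wA ndAB v vA i iA.
have v0 : \sum_(i in A) v i = 0 by rewrite (left_potential_sum wA vA) mul0r.
have := ndAB (glue A v (fun=> 0)) _ i; rewrite /glue iA inE iA; apply=> // k.
rewrite (sum_glue (fun j z => U k j * z)) // [X in _ + X]big1 ?addr0; last first.
  by move=> j _; rewrite mulr0.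
case/setUP => kS; first exact: vA.
rewrite (eq_bigr (fun j => c k * v j)) => [|j jA]; last by rewrite UBA.
by rewrite -mulr_sumr v0 mulr0.
Qed.

(* The two-by-two systems for the coefficients of the right and left potentials
   of a node with off-diagonal blocks a and b, where s and t are the sums of the
   potentials of its two diagonal blocks.  They are solvable even when their
   determinant 1 - a b s t vanishes, which forces a s = b s = a t = b t = 1. *)
Lemma scalar_system (a b s t : R) : 0 <= a -> a <= b -> 0 < s -> 0 < t ->
    b * s <= 1 -> b * t <= 1 ->
  exists x y x' y', [/\ x + a * y * t = 1, y + b * x * s = 1,
    x' + b * y' * t = 1, y' + a * x' * s = 1 &
    [/\ 0 <= x, 0 <= y, 0 < x * s + y * t,  b * (x * s + y * t) <= 1 &
     (b * (x * s + y * t) = 1 <-> b * s = 1 \/ b * t = 1) /\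
     (a * b * s * t != 1 -> (0 < x) = (a * t != 1) /\ (0 < y) = (b * s != 1))]].
Proof.
move=> a0 ab s0 t0 bs bt.
have b0 : 0 <= b by apply: le_trans ab.
have [s_ge0 t_ge0] : 0 <= s /\ 0 <= t by rewrite !ltW.
have as1 : a * s <= 1 by nra.
have at1 : a * t <= 1 by nra.
have [d0|d0] := eqVneq (a * b * s * t) 1.
  have as0 : 0 <= a * s by rewrite mulr_ge0 // ltW.
  have : 0 <= a * s * (1 - b * t) by rewrite mulr_ge0 // subr_ge0.
  have -> : a * s * (1 - b * t) = a * s - a * b * s * t by ring.
  rewrite d0 subr_ge0 => as_1; have {as_1}as_1 : a * s = 1 by lra.
  have bt_1 : b * t = 1 by rewrite -[b * t]mul1r -{1}as_1 -[RHS]d0; ring.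
  have bs_1 : b * s = 1 by nra.
  (* In the degenerate case the two equations of each system coincide up to a factor; any
     nonnegative solution will do. *)
  exists 1, 0, 1, 0; have -> : 1 * s + 0 * t = s by ring.
  by split; rewrite ?bs_1; (try lra); split=> //; split=> //; split; [left|].
set d := 1 - a * b * s * t.
have dn0 : d != 0 by rewrite /d subr_eq0 eq_sym.
have dgt0 : 0 < d.
  rewrite lt_neqAle eq_sym dn0 /d subr_ge0.
  have -> : a * b * s * t = (a * s) * (b * t) by ring.
  by rewrite andTb mulr_ile1 ?mulr_ge0.
(* Cramer's rule; [d] is the determinant of both systems. *)
exists ((1 - a * t) / d), ((1 - b * s) / d), ((1 - b * t) / d), ((1 - a * s) / d).
have d_ge0 := ltW dgt0.
(* This factorization yields both the bound on the sum and its equality case. *)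
have sumE : 1 - b * ((1 - a * t) / d * s + (1 - b * s) / d * t) =
    (1 - b * s) * (1 - b * t) / d.
  by rewrite /d; field.
split; try by rewrite /d; field.
split.
- by rewrite divr_ge0 // subr_ge0.
- by rewrite divr_ge0 // subr_ge0.
- have -> : (1 - a * t) / d * s + (1 - b * s) / d * t =
      (s * (1 - a * t) + t * (1 - b * s)) / d by rewrite /d; field.
  (* The two numerators cannot both vanish: [a * t = b * s = 1] would give [d = 0]. *)
  rewrite divr_gt0 //; have [at_1|at_1] := eqVneq (a * t) 1.
    rewrite at_1 subrr mulr0 add0r mulr_gt0 // subr_gt0 lt_neqAle bs andbT.
    apply: contra dn0 => /eqP bs_1; apply/eqP.
    by rewrite /d -at_1 -[a * t]mulr1 -bs_1; ring.
  by rewrite ltr_wpDr ?mulr_gt0 ?mulr_ge0 // ?subr_ge0 // subr_gt0 lt_neqAle at_1.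
- by rewrite -subr_ge0 sumE divr_ge0 // mulr_ge0 ?subr_ge0.
- split.
  + split=> [/eqP|].
      rewrite eq_sym -subr_eq0 sumE !mulf_eq0 invr_eq0 (negPf dn0) orbF !subr_eq0.
      by case/orP => /eqP ->; [left|right].
    move=> h; apply/eqP; rewrite eq_sym -subr_eq0 sumE.
    by case: h => ->; rewrite subrr ?mul0r ?mulr0 ?mul0r.
  + by rewrite !pmulr_lgt0 ?invr_gt0 // !subr_gt0 !lt_neqAle at1 bs !andbT.
Qed.

Lemma sum_scale_const S (f g : I -> R) c x : (forall j, j \in S -> f j = c) ->
  \sum_(j in S) f j * (x * g j) = c * x * \sum_(j in S) g j.
Proof. by move=> fc; rewrite mulr_sumr; apply: eq_bigr => j /fc ->; ring. Qed.

Lemma sum_scale S (f g : I -> R) x :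
  \sum_(j in S) f j * (x * g j) = x * \sum_(j in S) f j * g j.
Proof. by rewrite mulr_sumr; apply: eq_bigr => j _; ring. Qed.

(** The potentials of the blocks are rescaled by the solutions of [scalar_system]. Only the signs
    require nonsingularity: the rest serves to prove that the blocks inherit it. *)
Lemma ultrametric_node A B a b uA wA uB wB : [disjoint A & B] ->
    (forall i j, i \in A -> j \in B -> U i j = a) ->
    (forall i j, i \in B -> j \in A -> U i j = b) ->
    right_potential A uA -> left_potential A wA ->
    right_potential B uB -> left_potential B wB ->
    let s := \sum_(i in A) uA i in let t := \sum_(i in B) uB i in
    0 <= a -> a <= b -> 0 < s -> 0 < t -> b * s <= 1 -> b * t <= 1 ->
  exists u w, let su := \sum_(i in A :|: B) u i in
    [/\ right_potential (A :|: B) u, left_potential (A :|: B) w, 0 < su,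
      b * su <= 1 &
     (b * su = 1 <-> b * s = 1 \/ b * t = 1) /\
     (nonsingular_on (A :|: B) ->
       (forall i, i \in A -> (0 < u i) = (0 < uA i) && (a * t != 1)) /\
       (forall i, i \in B -> (0 < u i) = (0 < uB i) && (b * s != 1)))].
Proof.
move=> dAB UAB UBA uAP wAP uBP wBP s t a0 ab s0 t0 bs bt.
have [x [y [x' [y' [e1 e2 e3 e4 [x0 y0 su bsu [bsu1 xyP]]]]]]] :=
  scalar_system a0 ab s0 t0 bs bt.
have sumwA : \sum_(i in A) wA i = s by rewrite /s (left_potential_sum wAP uAP) mul1r.
have sumwB : \sum_(i in B) wB i = t by rewrite /t (left_potential_sum wBP uBP) mul1r.
exists (glue A (fun i => x * uA i) (fun i => y * uB i)).
exists (glue A (fun i => x' * wA i) (fun i => y' * wB i)).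
rewrite (sum_glue (fun=> id)) // -!mulr_sumr -/s -/t; split=> //.
- move=> i; rewrite (sum_glue (fun j z => U i j * z)) //; case/setUP => iS.
    rewrite sum_scale uAP // (@sum_scale_const _ _ _ a) -/t; last by move=> j; apply: UAB.
    by rewrite -[RHS]e1; ring.
  rewrite addrC sum_scale uBP // (@sum_scale_const _ _ _ b) -/s; last by move=> j; apply: UBA.
  by rewrite -[RHS]e2; ring.
- move=> j; rewrite (sum_glue (fun i z => z * U i j)) //.
  under eq_bigr do rewrite mulrC.
  under [X in _ + X]eq_bigr do rewrite mulrC.
  case/setUP => jS.
    rewrite sum_scale addrC (@sum_scale_const _ _ _ b) => [|i iB]; last exact: UBA.
    under [X in _ + _ * X]eq_bigr do rewrite mulrC.
    by rewrite wAP // sumwB -[RHS]e3; ring.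
  rewrite (@sum_scale_const _ _ _ a) => [|i iB]; last exact: UAB.
  rewrite addrC sum_scale addrC; under [X in _ + _ * X]eq_bigr do rewrite mulrC.
  by rewrite wBP // sumwA -[RHS]e4; ring.
split=> // nd; have [|xP yP] := xyP.
  (* if a b s t = 1 then (uA, - b s uB) is in the kernel *)
  apply/eqP => d0; have [i iA /eqP uA0] : exists2 i, i \in A & uA i != 0.
    apply/exists_inP; apply: contraTT s0 => /exists_inPn uA0.
    by rewrite /s big1 ?ltxx // => i /uA0; rewrite negbK => /eqP.
  apply: uA0; have := nd (glue A uA (fun j => - (b * s) * uB j)) _ i.
  rewrite /glue iA inE iA; apply=> // k.
  rewrite (sum_glue (fun j z => U k j * z)) // sum_scale; case/setUP => kS.
    rewrite uAP // (eq_bigr (fun j => a * uB j)) => [|j jB]; last by rewrite UAB.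
    by rewrite -mulr_sumr -/t -{1}d0; ring.
  rewrite uBP // (eq_bigr (fun j => b * uA j)) => [|j jB]; last by rewrite UBA.
  by rewrite -mulr_sumr -/s; ring.
split=> i iS.
  rewrite /glue iS -xP andbC; have [->|xn0] := eqVneq x 0; first by rewrite mul0r ltxx.
  have x_gt0 : 0 < x by rewrite lt_neqAle eq_sym xn0.
  by rewrite pmulr_rgt0 // x_gt0.
rewrite /glue (disjointFl dAB iS) -yP andbC.
have [->|yn0] := eqVneq y 0; first by rewrite mul0r ltxx.
have y_gt0 : 0 < y by rewrite lt_neqAle eq_sym yn0.
by rewrite pmulr_rgt0 // y_gt0.
Qed.

Lemma sum_sub_delta S (f g : I -> R) n x c : n \in S ->
  \sum_(j in S) f j * (x * g j - c * (j == n)%:R) =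
  x * (\sum_(j in S) f j * g j) - c * f n.
Proof.
move=> nS; rewrite -sum_scale (eq_bigr (fun j => f j * (x * g j) - c * f j * (j == n)%:R)).
  rewrite sumrB; congr (_ - _); rewrite (bigD1 n nS) /= eqxx mulr1 big1 ?addr0 //.
  by move=> j /andP[_ /negPf ->]; rewrite mulr0.
by move=> j _; ring.
Qed.

Lemma spine_node A B a n uA uB : [disjoint A & B] -> n \in B ->
    (forall i j, i \in A -> j \in B -> U i j = a) ->
    (forall i j, i \in B -> j \in A -> U i j = U i n) ->
    right_potential A uA -> right_potential B uB ->
    0 < \sum_(i in A) uA i -> a * \sum_(i in A) uA i <= 1 ->
    a * \sum_(i in B) uB i <= 1 -> nonsingular_on (A :|: B) ->
  a * \sum_(i in A) uA i != 1 /\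
  exists2 u, right_potential (A :|: B) u &
    (forall i, i \in A -> (0 < u i) = (0 < uA i) && (a * \sum_(j in B) uB j != 1)) /\
    (forall i, i \in B -> i != n -> u i = uB i).
Proof.
move=> dAB nB UAB UBA uAP uBP; set s := \sum_(i in A) _; set t := \sum_(i in B) _.
move=> s0 as1 at1 nd.
have as_neq1 : a * s != 1.
  (* if a s = 1 then (uA, - s e_n) is in the kernel *)
  apply/eqP => as_1; have [i iA /eqP uA0] : exists2 i, i \in A & uA i != 0.
    apply/exists_inP; apply: contraTT s0 => /exists_inPn uA0.
    by rewrite /s big1 ?ltxx // => i /uA0; rewrite negbK => /eqP.
  apply: uA0; have := nd (glue A uA (fun j => 0 * uB j - s * (j == n)%:R)) _ i.
  rewrite /glue iA inE iA; apply=> // k.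
  rewrite (sum_glue (fun j z => U k j * z)) // sum_sub_delta //; case/setUP => kS.
    by rewrite uAP // UAB // mul0r sub0r mulrC as_1 subrr.
  rewrite (eq_bigr (fun j => U k n * uA j)) => [|j jB]; last by rewrite UBA.
  by rewrite -mulr_sumr -/s; ring.
have as_lt1 : 0 < 1 - a * s by rewrite subr_gt0 lt_neqAle as_neq1.
(* The rows in [A] require [x + a * (t - x * s) = 1]. The rows in [B] hold for every [x]: lowering
   the entry at [n] by [x * s] cancels the contribution of [A]. *)
split=> //; set x := (1 - a * t) / (1 - a * s).
exists (glue A (fun i => x * uA i) (fun j => 1 * uB j - x * s * (j == n)%:R)).
  move=> k; rewrite (sum_glue (fun j z => U k j * z)) // sum_sub_delta //.
  rewrite sum_scale; case/setUP => kS.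
    rewrite uAP // UAB // (eq_bigr (fun j => a * uB j)) => [|j jB]; last by rewrite UAB.
    by rewrite -mulr_sumr -/t /x; field; rewrite gt_eqF.
  rewrite uBP // (eq_bigr (fun j => U k n * uA j)) => [|j jB]; last by rewrite UBA.
  by rewrite -mulr_sumr -/s; ring.
split=> i iS; last first.
  by move=> /negPf ni; rewrite /glue (disjointFl dAB iS) ni mulr0 subr0 mul1r.
rewrite /glue iS andbC; have [at_1|at_1] := eqVneq (a * t) 1.
  by rewrite /x at_1 subrr !mul0r ltxx.
by rewrite pmulr_rgt0 // divr_gt0 // subr_gt0 lt_neqAle at_1.
Qed.
End Potentials.

(** * Dyadic trees and U-matrices *)

Section DyadicTrees.
Variables (m : nat) (D : dyadicTree m).
Implicit Types (L : D) (i j : 'I_m.+1).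
Let treeD := adj_tree D.
Let n : 'I_m.+1 := ord_max.

Lemma in_below L i : (i \in below L) = dle L (lf D i).
Proof. by rewrite inE. Qed.

Lemma below_root : below (troot D) = setT.
Proof. by apply/setP => i; rewrite !inE /dle tle_root. Qed.

Lemma below_leaf i : below (lf D i) = [set i].
Proof.
apply/setP => j; rewrite !inE; apply/idP/eqP => [ij|->]; last exact: tle_refl.
apply/esym/(@lf_inj m D)/eqP; apply: contraT => nij.
have [c] := succ_toward treeD ij nij.
have : dleaf (lf D i) by apply/lf_image; exists i.
by move/eqP->; rewrite inE.
Qed.

Lemma tplus_succ L : ~~ dleaf L -> tplus L \in succs (@adj m D) (troot D) L.
Proof. by case/dyadic => _ ->; rewrite !inE eqxx orbT. Qed.

Lemma tminus_succ L : ~~ dleaf L -> tminus L \in succs (@adj m D) (troot D) L.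
Proof. by case/dyadic => _ ->; rewrite !inE eqxx. Qed.

Lemma dle_tplus L : ~~ dleaf L -> dle L (tplus L).
Proof. by move/tplus_succ/(succs_tle treeD). Qed.

Lemma dle_tminus L : ~~ dleaf L -> dle L (tminus L).
Proof. by move/tminus_succ/(succs_tle treeD). Qed.

Lemma dle_trans s t u : @dle m D s t -> dle t u -> dle s u.
Proof. exact: tle_trans. Qed.

Lemma below_node L : ~~ dleaf L -> below L = below (tminus L) :|: below (tplus L).
Proof.
move=> nlL; apply/setP => i; rewrite in_setU !in_below.
apply/idP/orP => [Li|[|]]; last 2 first.
- exact/dle_trans/dle_tminus.
- exact/dle_trans/dle_tplus.
have nLi : L != lf D i.
  by apply: contraNneq nlL => ->; apply/lf_image; exists i.
have [c] := succ_toward treeD Li nLi.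
by case: (dyadic nlL) => _ ->; rewrite !inE => /orP[]/eqP->; [left|right].
Qed.

Lemma below_disjoint L : ~~ dleaf L -> [disjoint below (tminus L) & below (tplus L)].
Proof.
move=> nlL; apply/pred0P => i /=; rewrite !in_below; apply/andP => -[mi pi].
have [/eqP[]] := dyadic nlL.
exact: (succ_unique treeD (tminus_succ nlL) (tplus_succ nlL) mi pi).
Qed.

Lemma dmeet_node L i j : ~~ dleaf L -> i \in below (tminus L) ->
  j \in below (tplus L) -> dmeet (lf D i) (lf D j) = L.
Proof.
rewrite !in_below => nlL; have [neq _] := dyadic nlL.
exact: (tmeet_succs treeD (tminus_succ nlL) (tplus_succ nlL) neq).
Qed.

Lemma dmeet_nodeC L i j : ~~ dleaf L -> i \in below (tplus L) ->
  j \in below (tminus L) -> dmeet (lf D i) (lf D j) = L.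
Proof.
rewrite !in_below => nlL; have [neq _] := dyadic nlL; rewrite eq_sym in neq.
exact: (tmeet_succs treeD (tplus_succ nlL) (tminus_succ nlL) neq).
Qed.

Lemma dyadic_ind (P : D -> Prop) : (forall i, P (lf D i)) ->
    (forall L, ~~ dleaf L -> P (tminus L) -> P (tplus L) -> P L) ->
  forall L, P L.
Proof.
move=> Pleaf Pnode; apply: (tree_ind treeD (r := troot D)) => L Psucc.
have [/lf_image[i <-] //|nlL] := boolP (dleaf L).
by apply: Pnode => //; apply: Psucc; [apply: tminus_succ|apply: tplus_succ].
Qed.

(** Translates the conditions on the path from the root to [n] (the spine) into leaf sets. *)
Lemma spineE L : (L \in dgeod (troot D) (lfn D)) = (n \in below L).
Proof. by rewrite in_below /dgeod geod_sym // mem_rev. Qed.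

(** * Entries, potentials and the edges in Gamma *)

Section Entries.
Variables (R : realFieldType) (alpha beta : D -> R) (U : 'M[R]_m.+1).
Hypotheses (hU : is_Umatrix alpha beta U) (U_unit : U \in unitmx).
Let al i := alpha (lf D i).

Definition avoids i L := dgeod_edges (lf D i) L :&: Gamma alpha beta == set0.

Lemma avoids_leaf i : avoids i (lf D i).
Proof. by rewrite /avoids /dgeod_edges geod_edges_refl // set0I. Qed.

Lemma avoids_succ L c i : c \in succs (@adj m D) (troot D) L -> i \in below c ->
  avoids i L = ([set L; c] \notin Gamma alpha beta) && avoids i c.
Proof.
rewrite in_below /avoids /dgeod_edges => cL ci.
rewrite (geod_edges_succ treeD cL ci) setIUl setU_eq0; congr (_ && _).
by rewrite setI_eq0 disjoints1.
Qed.

(** An edge determines its two ends and the two successors differ, so only the first family of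
    [Gamma], at [L] itself, can contain this edge. *)
Lemma Gamma_minus L : ~~ dleaf L -> ([set L; tminus L] \in Gamma alpha beta) =
  [exists i in below (tplus L), alpha L == al i].
Proof.
move=> nlL; have [neq _] := dyadic nlL; apply/setUP/exists_inP.
  case=> /imsetP[M]; rewrite !inE => /andP[nlM /exists_inP[i iM]].
    rewrite inE => /andP[_ e] /(edge_inj treeD (tminus_succ nlL) (tminus_succ nlM)) [LM _].
    by exists i; rewrite LM.
  move=> _ /(edge_inj treeD (tminus_succ nlL) (tplus_succ nlM)) [LM].
  by rewrite -LM => /eqP; rewrite (negPf neq).
case=> i iL e; left; apply/imsetP; exists L => //; rewrite inE nlL.
apply/exists_inP; exists i => //; rewrite inE e andbT.
by apply: dle_trans (dle_tplus nlL) _; rewrite -in_below.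
Qed.

Lemma Gamma_plus L : ~~ dleaf L -> ([set L; tplus L] \in Gamma alpha beta) =
  [exists i in below (tminus L), beta L == al i].
Proof.
move=> nlL; have [neq _] := dyadic nlL; apply/setUP/exists_inP.
  case=> /imsetP[M]; rewrite !inE => /andP[nlM /exists_inP[i iM]].
    move=> _ /(edge_inj treeD (tplus_succ nlL) (tminus_succ nlM)) [LM].
    by rewrite -LM => /esym/eqP; rewrite (negPf neq).
  rewrite inE => /andP[_ e] /(edge_inj treeD (tplus_succ nlL) (tplus_succ nlM)) [LM _].
  by exists i; rewrite LM // /al (U_leaf hU).
case=> i iL e; right; apply/imsetP; exists L => //; rewrite inE nlL.
apply/exists_inP; exists i => //; rewrite inE -(U_leaf hU) e andbT.
by apply: dle_trans (dle_tminus nlL) _; rewrite -in_below.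
Qed.

Lemma alpha_below L i : i \in below L -> alpha L <= al i.
Proof. by rewrite in_below => /(U_mono hU)[]. Qed.

Lemma beta_below L i : i \in below L -> beta L <= al i.
Proof. by rewrite in_below /al (U_leaf hU) => /(U_mono hU)[]. Qed.

Lemma below_neq L i j : ~~ dleaf L -> i \in below (tminus L) ->
  j \in below (tplus L) -> i != j.
Proof.
move=> nlL iL jL; apply: contraTneq iL => ->.
by rewrite (disjointFl (below_disjoint nlL) jL).
Qed.

Lemma entry_upper L i j : ~~ dleaf L -> i \in below (tminus L) ->
  j \in below (tplus L) -> U i j = alpha L.
Proof.
move=> nlL iL jL; have nij := below_neq nlL iL jL.
have mE := dmeet_node nlL iL jL; rewrite -[in RHS]mE.
by apply: (U_upper hU nij); rewrite -/(dmeet _ _) mE.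
Qed.

Lemma entry_lower L i j : ~~ dleaf L -> i \in below (tplus L) ->
  j \in below (tminus L) -> U i j = beta (dmax L (dmeet (lf D i) (lfn D))).
Proof.
move=> nlL iL jL; have := below_neq nlL jL iL; rewrite eq_sym => nij.
have mE := dmeet_nodeC nlL iL jL; rewrite -{1}[in RHS]mE.
by apply: (U_lower hU nij); rewrite -/(dmeet _ _) mE.
Qed.

(** The meet of [i] and [n] precedes [n], so it cannot lie above [L], and [dmax] returns [L]. *)
Lemma entry_lower_ultrametric L i j : ~~ dleaf L -> n \notin below L ->
  i \in below (tplus L) -> j \in below (tminus L) -> U i j = beta L.
Proof.
move=> nlL nL iL jL; rewrite (entry_lower nlL iL jL) /dmax ifN //.
apply: contra nL => LM; rewrite in_below; apply: dle_trans LM _.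
exact: tmeet_tler.
Qed.

Lemma al_ge0 i : 0 <= al i.
Proof. by have [] := U_nonneg hU (lf D i). Qed.

(** Each entry of row [i] is a value of [alpha] or [beta] at a vertex preceding the leaf [i], hence
    between 0 and [al i]. *)
Lemma row_eq0 L i j : al i = 0 -> i \in below L -> j \in below L -> U i j = 0.
Proof.
move=> i0; elim/dyadic_ind: L => [k|L nlL IHm IHp].
  by rewrite !below_leaf => /set1P <- /set1P ->; rewrite (U_diag hU).
have zero (x : R) : 0 <= x -> x <= al i -> x = 0.
  by rewrite i0 => x0 x1; apply/eqP; rewrite eq_le x1.
move=> iL; move: (iL); rewrite !(below_node nlL) => /setUP[] iL' /setUP[] jL'.
- exact: IHm.
- rewrite (entry_upper nlL) //; apply: zero; last exact: alpha_below.
  by have [] := U_nonneg hU L.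
- rewrite (entry_lower nlL) //; apply: zero.
    by have [] := U_nonneg hU (dmax L (dmeet (lf D i) (lfn D))).
  apply: beta_below; rewrite in_below /dmax; case: ifP => _; last by rewrite -in_below.
  exact: tmeet_tle.
- exact: IHp.
Qed.

Lemma al_gt0 i : 0 < al i.
Proof.
rewrite lt_neqAle al_ge0 andbT eq_sym; apply/eqP => i0.
have /matrixP/(_ i i) := mulmxV U_unit; rewrite !mxE eqxx big1 => [/esym/eqP|j _].
  by rewrite oner_eq0.
by rewrite (@row_eq0 (troot D)) ?mul0r // below_root inE.
Qed.

(** Passes from [L] to its parent, with [c] the parent's [alpha] or [beta]: the scalar condition
    [c * s = 1] becomes membership of an edge in [Gamma]. Either side forces [c = beta L], as
    [beta L] bounds every [al i] from below. *)
Lemma beta_sum_alpha L s c : 0 < s -> beta L * s <= 1 ->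
    (beta L * s = 1 <-> exists2 i, i \in below L & al i = beta L) ->
    c <= beta L ->
  c * s <= 1 /\ (c * s == 1) = [exists i in below L, c == al i].
Proof.
move=> s0 bs bsE cb; split.
  by apply: le_trans bs; rewrite ler_pM2r.
apply/eqP/exists_inP => [cs|[i iL /eqP cE]].
  have cE : c = beta L.
    apply/eqP; rewrite eq_le cb -(ler_pM2r s0) cs //.
  have /bsE[i iL e] : beta L * s = 1 by rewrite -cE.
  by exists i; rewrite // cE e.
have cE' : c = beta L by apply/eqP; rewrite eq_le cb cE beta_below.
by rewrite cE'; apply/bsE; exists i; rewrite // -cE.
Qed.

(** Induction from the leaves. The bound with its equality case is the invariant that feeds
    [scalar_system] at the parent. *)
Lemma ultrametric_potential L : n \notin below L ->
  exists u w, let s := \sum_(i in below L) u i in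
    [/\ right_potential U (below L) u, left_potential U (below L) w, 0 < s,
      beta L * s <= 1 &
     (beta L * s = 1 <-> exists2 i, i \in below L & al i = beta L) /\
     (nonsingular_on U (below L) ->
        forall i, i \in below L -> (0 < u i) = avoids i L)].
Proof.
elim/dyadic_ind: L => [k nk|L nlL IHm IHp].
  have k0 := al_gt0 k; have kn0 : al k != 0 by rewrite gt_eqF.
  exists (fun=> (al k)^-1), (fun=> (al k)^-1).
  rewrite below_leaf big_set1 -(U_leaf hU) -/(al k).
  split.
  - by move=> i /set1P ->; rewrite big_set1 (U_diag hU) mulfV.
  - by move=> i /set1P ->; rewrite big_set1 (U_diag hU) mulVf.
  - by rewrite invr_gt0.
  - by rewrite mulfV.
  - split=> [|_ i /set1P ->]; last by rewrite invr_gt0 k0 avoids_leaf.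
    by rewrite mulfV //; split=> // _; exists k; rewrite ?set11.
rewrite below_node // in_setU negb_or => /andP[nm np].
have [uA [wA [uAP wAP sA bA [bAE sgnA]]]] := IHm nm.
have [uB [wB [uBP wBP sB bB [bBE sgnB]]]] := IHp np.
have nL : n \notin below L by rewrite below_node // in_setU negb_or nm.
have dAB := below_disjoint nlL.
have UAB := entry_upper nlL.
have UBA i j := entry_lower_ultrametric nlL nL (i := i) (j := j).
have [_ leA] := U_mono hU (dle_tminus nlL).
have [_ leB] := U_mono hU (dle_tplus nlL).
have ab := U_le hU L.
have a0 : 0 <= alpha L by have [] := U_nonneg hU L.
have [bsA bsAE] := beta_sum_alpha sA bA bAE leA.
have [bsB bsBE] := beta_sum_alpha sB bB bBE leB.
have [_ asBE] := beta_sum_alpha sB bB bBE (le_trans ab leB).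
have [u [w [uP wP s0 bs [bsE sgn]]]] :=
  ultrametric_node dAB UAB UBA uAP wAP uBP wBP a0 ab sA sB bsA bsB.
exists u, w; split=> //; split.
  split=> [/bsE[]/eqP|[i]].
  - by rewrite bsAE => /exists_inP[i iL /eqP]; exists i; rewrite ?inE -?in_below ?iL.
  - by rewrite bsBE => /exists_inP[i iL /eqP]; exists i; rewrite ?inE -?in_below ?iL ?orbT.
  rewrite in_setU => iL e; apply/bsE; case/orP: iL => iL; [left|right]; apply/eqP.
    by rewrite bsAE; apply/exists_inP; exists i; rewrite // e.
  by rewrite bsBE; apply/exists_inP; exists i; rewrite // e.
move=> nd i; have [sgA sgB] := sgn nd; case/setUP=> iL.
  (* The factor on [tminus L] vanishes through the sum over the opposite block, just as [Gamma]
     tests the leaves of the opposite successor. *)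
  rewrite (avoids_succ (tminus_succ nlL) iL) Gamma_minus // -asBE andbC sgA // sgnA //.
  exact: nonsingular_part dAB UBA wAP nd.
rewrite (avoids_succ (tplus_succ nlL) iL) Gamma_plus // -bsAE andbC sgB // sgnB //.
rewrite setUC in nd; rewrite disjoint_sym in dAB.
exact: nonsingular_part dAB UAB wBP nd.
Qed.

(** * Entries at vertices of the spine *)

Lemma spine_plus L : ~~ dleaf L -> n \in below L -> n \in below (tplus L).
Proof. by move=> nlL nL; rewrite -spineE; apply: (U_spine hU); rewrite ?spineE. Qed.

Lemma spine_meet L i : n \in below L -> i \in below L ->
  dle L (dmeet (lf D i) (lfn D)) /\ U i n = beta (dmeet (lf D i) (lfn D)).
Proof.
elim/dyadic_ind: L => [k|L nlL IHm IHp].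
  rewrite below_leaf => /set1P <- /set1P ->.
  rewrite /dmeet tmeetxx ?/dle ?tle_refl //; split=> //.
  by rewrite (U_diag hU) (U_leaf hU).
move=> nL; have np := spine_plus nlL nL.
rewrite below_node // => /setUP[] iL; last first.
  have [le ->] := IHp np iL; split=> //; apply: dle_trans le; exact: dle_tplus.
rewrite (dmeet_node nlL iL np) /dle tle_refl //; split=> //.
by rewrite (entry_upper nlL iL np) (U_spine_eq hU) // spineE.
Qed.

(** The meet of [i] and [n] now lies above [L], so [dmax] returns it, whatever [j] is. *)
Lemma entry_lower_spine L i j : ~~ dleaf L -> n \in below L ->
  i \in below (tplus L) -> j \in below (tminus L) -> U i j = U i n.
Proof.
move=> nlL nL iL jL; have iL' : i \in below L by rewrite below_node // in_setU iL orbT.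
have [le ->] := spine_meet nL iL'.
by rewrite (entry_lower nlL iL jL) /dmax le.
Qed.

(** At each node of the spine [n] is on the plus side, so a column from the minus side repeats the
    diagonal entry. *)
Lemma last_row L j : n \in below L -> j \in below L -> U n j = al n.
Proof.
elim/dyadic_ind: L => [k|L nlL _ IHp].
  by rewrite below_leaf => /set1P <- /set1P ->; rewrite (U_diag hU).
move=> nL; have np := spine_plus nlL nL; rewrite below_node // => /setUP[] jL.
  by rewrite (entry_lower_spine nlL nL np jL) (U_diag hU).
exact: IHp.
Qed.

Lemma left_potential_spine L : n \in below L ->
  left_potential U (below L) (fun i => (al n)^-1 * (i == n)%:R).
Proof.
move=> nL j jL; rewrite (bigD1 n nL) /= eqxx big1 => [|i /andP[_ /negPf->]].
  by rewrite addr0 mulr1 (last_row nL jL) mulVf // gt_eqF ?al_gt0.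
by rewrite mulr0 mul0r.
Qed.

Lemma sum_potential_spine L u : n \in below L -> right_potential U (below L) u ->
  \sum_(i in below L) u i = (al n)^-1.
Proof.
move=> nL uP; rewrite (left_potential_sum (left_potential_spine nL) uP) mul1r.
rewrite (bigD1 n nL) /= eqxx big1 ?addr0 ?mulr1 // => i /andP[_ /negPf->].
by rewrite mulr0.
Qed.

(** * Nonsingularity of the diagonal blocks *)

Lemma nonsingular_succ L c : c \in succs (@adj m D) (troot D) L ->
  nonsingular_on U (below L) -> nonsingular_on U (below c).
Proof.
move=> cL; have nlL : ~~ dleaf L by apply: contraTN cL => /eqP->; rewrite inE.
have [_ succE] := dyadic nlL; move: cL; rewrite succE below_node // => /set2P cL nd.
have dAB := below_disjoint nlL.
have lp (M : D) : exists w, left_potential U (below M) w.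
  have [nM|nM] := boolP (n \in below M).
    by eexists; apply: left_potential_spine.
  by have [u [w [_ wP _ _ _]]] := ultrametric_potential nM; exists w.
have [[wA wAP] [wB wBP]] := (lp (tminus L), lp (tplus L)).
case: cL => ->.
  (* In both cases the rows of the lower left block are constant, equal to [U i n] on the spine and
     to [beta L] off it. *)
  have [nL|nL] := boolP (n \in below L).
    exact: nonsingular_part dAB (fun i j => @entry_lower_spine L i j nlL nL) wAP nd.
  exact: nonsingular_part dAB (fun i j => @entry_lower_ultrametric L i j nlL nL) wAP nd.
rewrite setUC in nd; rewrite disjoint_sym in dAB.
exact: nonsingular_part dAB (fun i j => @entry_upper L i j nlL) wBP nd.
Qed.

Lemma nonsingular_below L : nonsingular_on U (below L).
Proof.
elim/(tree_ind_from_root treeD (r := troot D)): L => [|L c]; last exact: nonsingular_succ.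
rewrite below_root => v v0 i _.
have : U *m \col_j v j = 0.
  apply/matrixP => k j; rewrite !mxE -[RHS](v0 k) //.
  by apply: eq_big => [l|l _]; rewrite ?inE // !mxE.
move/(congr1 (mulmx (invmx U))); rewrite mulKmx // mulmx0 => /matrixP/(_ i 0).
by rewrite !mxE.
Qed.

(** [Gamma] tests all leaves of [tplus L], whereas the sum of the potential sees only [al n]. The
    second claim reconciles the two. *)
Lemma spine_potential L : n \in below L ->
  (exists2 u, right_potential U (below L) u &
     forall i, i \in below L -> i != n -> (0 < u i) = avoids i L) /\
  (forall i, i \in below L -> alpha L = al i -> alpha L = al n).
Proof.
elim/dyadic_ind: L => [k|L nlL _ IHp].
  rewrite below_leaf => /set1P <-; split; last by move=> i /set1P ->.
  exists (fun=> (al n)^-1) => i /set1P ->; last by rewrite eqxx.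
  by rewrite big_set1 (U_diag hU) mulfV // gt_eqF ?al_gt0.
move=> nL; have np := spine_plus nlL nL; have [[uB uBP sgnB] minB] := IHp np.
have nm : n \notin below (tminus L) by rewrite (disjointFl (below_disjoint nlL) np).
have [uA [wA [uAP wAP sA bA [bAE sgnA]]]] := ultrametric_potential nm.
have abL : alpha L = beta L by apply: (U_spine_eq hU); rewrite spineE.
have [aA leA] := U_mono hU (dle_tminus nlL).
have [aB _] := U_mono hU (dle_tplus nlL).
rewrite -abL in leA; have [asA asAE] := beta_sum_alpha sA bA bAE leA.
have sBE := sum_potential_spine np uBP.
have an0 := al_gt0 n.
have asB : alpha L * \sum_(i in below (tplus L)) uB i <= 1.
  by rewrite sBE ler_pdivrMr // mul1r alpha_below.
have nd := @nonsingular_below L; rewrite below_node // in nd.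
have [asA_neq1 [u uP [sgnuA uBE]]] := spine_node (below_disjoint nlL) np
  (fun i j => @entry_upper L i j nlL) (fun i j => @entry_lower_spine L i j nlL nL)
  uAP uBP sA asA asB nd.
(* A leaf on the minus side would give the excluded equality of [asA_neq1]; one on the plus side
   forces [alpha L = alpha (tplus L)] by monotonicity. *)
have minL i : i \in below L -> alpha L = al i -> alpha L = al n.
  rewrite below_node // => /setUP[] iL e.
    by case/negP: asA_neq1; rewrite asAE; apply/exists_inP; exists i; rewrite // e.
  have LE : alpha L = alpha (tplus L) by apply/eqP; rewrite eq_le aB {1}e alpha_below.
  by rewrite LE; apply: (minB i); rewrite // -LE.
split=> //; exists u; rewrite below_node // => i /setUP[] iL ni.
  rewrite (avoids_succ (tminus_succ nlL) iL) Gamma_minus // sgnuA // sgnA //; last first.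
    exact: nonsingular_below.
  rewrite andbC; congr (~~ _ && _); rewrite sBE; apply/eqP/exists_inP.
    by move/divr1_eq => e; exists n; rewrite // e.
  case=> j jL /eqP /minL -> //; first by rewrite mulfV ?gt_eqF.
  by rewrite below_node // in_setU jL orbT.
(* By [asA_neq1] the edge to [tplus L] is never in [Gamma], and [u] agrees with [uB] away from
   [n]. *)
rewrite (avoids_succ (tplus_succ nlL) iL) Gamma_plus // -abL -asAE asA_neq1.
by rewrite uBE // sgnB.
Qed.

Lemma potential_sign L : exists2 u, right_potential U (below L) u &
  forall i, i \in below L -> i != n -> (0 < u i) = avoids i L.
Proof.
have [nL|nL] := boolP (n \in below L); first by have [] := spine_potential nL.
have [u [w [uP _ _ _ [_ sgn]]]] := ultrametric_potential nL.
exists u => // i iL _; apply: sgn => //.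
exact: nonsingular_below.
Qed.

End Entries.
End DyadicTrees.

(** * From functions on leaf sets to submatrices *)

Section Submatrices.
Variable R : realFieldType.

Lemma potentialE k (V : 'M[R]_k) u i : V \in unitmx ->
  (forall i, \sum_j V i j * u j = 1) -> potential V i 0 = u i.
Proof.
move=> Vunit uP; have -> : u i = (\col_j u j) i 0 by rewrite mxE.
rewrite /potential -[in RHS](mulKmx Vunit (\col_j u j)); congr ((_ *m _) _ _).
apply/matrixP => a b; rewrite !mxE -[LHS](uP a).
by apply: eq_bigr => j _; rewrite mxE.
Qed.

Variable k : nat.

Lemma submx_on_unit (V : 'M[R]_k) (S : {set 'I_k}) :
  nonsingular_on V S -> submx_on S V \in unitmx.
Proof.
(* Freeness concerns row vectors, whereas [nonsingular_on] concerns columns; hence the transpose. *)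
move=> nd; rewrite -unitmx_tr -row_free_unit; apply: inj_row_free => v v0.
apply/matrixP => a b; rewrite ord1 mxE.
have enumS (c : 'I_#|S|) : enum_val c \in S by apply: enum_valP.
(* Extends [v] by 0 outside [S]; the match supplies the membership proof that [enum_rank_in]
   takes. *)
pose f i := if i \in S =P true is ReflectT iS then v 0 (enum_rank_in iS i) else 0.
have fE (c : 'I_#|S|) : f (enum_val c) = v 0 c.
  rewrite /f; case: eqP => [iS|]; last by rewrite enumS.
  by rewrite enum_valK_in.
rewrite -fE; apply: nd (enumS b) => i iS.
rewrite big_enum_val /=; move/matrixP/(_ 0 (enum_rank_in iS i)): v0.
rewrite !mxE => e; rewrite -[RHS]e; apply: eq_bigr => c _.
by rewrite !mxE fE enum_rankK_in // mulrC.
Qed.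

Lemma exit_roots_onE (V : 'M[R]_k) (S : {set 'I_k}) u i :
  nonsingular_on V S -> right_potential V S u -> i \in S ->
  (i \in exit_roots_on S V) = (0 < u i).
Proof.
move=> nd uP iS.
have potE c : potential (submx_on S V) c 0 = u (enum_val c).
  apply: (potentialE (u := fun c : 'I_#|S| => u (enum_val c))); first exact: submx_on_unit.
  move=> {}c; rewrite -[RHS](uP (enum_val c)) ?enum_valP // [RHS]big_enum_val.
  by apply: eq_bigr => j _; rewrite mxE.
apply/imsetP/idP => [[c]|ui]; first by rewrite inE potE => ? ->.
exists (enum_rank_in iS i); last by rewrite enum_rankK_in.
by rewrite inE potE enum_rankK_in.
Qed.

End Submatrices.

Theorem theorem3p2 (R : realFieldType) (m : nat) (D : dyadicTree m)
    (alpha beta : D -> R) (U : 'M[R]_m.+1)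
    (hU : is_Umatrix alpha beta U) (U_unit : U \in unitmx) :
  (forall i : 'I_m.+1, i != ord_max ->
     (i \in exit_roots U <->
      dgeod_edges (lf D i) (troot D) :&: Gamma alpha beta = set0)) /\
  (forall (L : D) (i : 'I_m.+1), i \in below L -> i != ord_max ->
     (i \in exit_roots_on (below L) U <->
      dgeod_edges (lf D i) L :&: Gamma alpha beta = set0)).
Proof.
split=> [i ni|L i iL ni].
  (* At the root [U] is treated directly, not as its submatrix on the full set, which has another
     index type. *)
  have [u uP sgn] := potential_sign hU U_unit (troot D); rewrite below_root in uP sgn.
  rewrite inE (potentialE (u := u)) // => [|j]; last first.
    by rewrite -[RHS](uP j) ?inE //; apply: eq_bigl => l; rewrite inE.
  by rewrite sgn ?inE //; split=> /eqP.
have [u uP sgn] := potential_sign hU U_unit L.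
have nd := @nonsingular_below m D R alpha beta U hU U_unit L.
rewrite (exit_roots_onE nd uP iL) sgn //.
by split=> /eqP.
Qed.
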